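(* Let $p$ be a prime. For any integers $a,b,m,n$, if the ordered pair $(m,n)$ is congruent modulo $p$ (componentwise) to one of $(a,b)$, $(-a-b,b)$, $(-a,-b)$, $(a+b,-b)$, then $\theta_{\Lambda_{m,n}}(q)=\theta_{\Lambda_{a,b}}(q)$.
   Context: Let $\ell>0$ be a square-free integer with $\ell\equiv 3 \pmod 4$, and let $d$ be the positive integer with $\ell=4d-1$. Let $K=\mathbb{Q}(\sqrt{-\ell})$, with ring of integers $\mathcal{O}_K=\mathbb{Z}[\omega_\ell]$, where $\omega_\ell=\frac{-1+\sqrt{-\ell}}{2}$. For a prime $p$ and integers $a,b$, let $\Lambda_{a,b}$ denote the coset $a-b\omega_\ell+p\mathcal{O}_K$, with theta series $$\theta_{\Lambda_{a,b}}(q)=\sum_{m,n\in\mathbb{Z}}q^{|a+mp-(b+np)\omega_\ell|^2}=\sum_{m,n\in\mathbb{Z}}q^{Q_d(mp+a,\,np+b)},\qquad Q_d(x,y)=|x-y\omega_\ell|^2=x^2+xy+dy^2.$$ *)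

(* Defs.v *)
From HB Require Import structures.
From mathcomp Require Import all_boot all_order all_algebra all_field.
From mathcomp Require Import finmap.
From mathcomp Require Import boolp classical_sets functions cardinality.
From mathcomp Require Import zify ring lra.

Set Implicit Arguments.
Unset Strict Implicit.
Unset Printing Implicit Defensive.

Import Order.TTheory GRing.Theory Num.Theory.
Local Open Scope classical_set_scope.
Local Open Scope ring_scope.

Definition square_free (n : nat) : Prop :=
  forall k : nat, (k ^ 2 %| n)%N -> k = 1%N.

(** [K l] is Q(sqrt(-l)) inside the field [algC] of complex algebraic
    numbers, and [OK l] is its ring of integers. *)
Definition sqrtNeg (l : nat) : algC := 'i * sqrtC l%:R.

Definition omega (l : nat) : algC := (-1 + sqrtNeg l) / 2.

Definition K (l : nat) : set algC :=
  [set z | exists x y : rat, z = ratr x + ratr y * sqrtNeg l].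

Definition OK (l : nat) : set algC := K l `&` [set z | z \in Aint].

Definition Lambda (l p : nat) (a b : int) : set algC :=
  [set a%:~R - b%:~R * omega l + p%:R * u | u in OK l].

(** A formal power series in q is given by its coefficients, and
    [qsum A e] is the formal sum of q^(e t) over t in A: the coefficient of
    q^N is the number of t in A with e t = N.  [fset_set] is [fset0] on an
    infinite set and exponents outside nat are ignored; neither happens for
    the series below, by [Lambda_finite] and [Lambda_norm_nat]. *)
Definition qseries : Type := nat -> int.

Definition qsum (T : choiceType) (A : set T) (e : T -> algC) : qseries :=
  fun N => Posz #|` fset_set [set t | A t /\ e t = N%:R]|.

Definition theta (A : set algC) : qseries := qsum A (fun z => `|z| ^+ 2).

Definition Qd (d : nat) (x y : int) : int := x ^+ 2 + x * y + d%:Z * y ^+ 2.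

Lemma sqrtNeg_sqr l : sqrtNeg l ^+ 2 = - l%:R.
Proof. by rewrite exprMn sqrCi sqrtCK mulN1r. Qed.

Lemma sqrtNeg_conj l : (sqrtNeg l)^* = - sqrtNeg l.
Proof.
rewrite rmorphM /= conjCi mulNr; congr (- (_ * _)).
by apply: conj_Creal; rewrite sqrtC_real // ler0n.
Qed.

Lemma sqrtNeg_neq0 l : (0 < l)%N -> sqrtNeg l != 0.
Proof. by move=> l0; rewrite mulf_neq0 ?neq0Ci // sqrtC_eq0 pnatr_eq0 -lt0n. Qed.

Lemma conj_rat (x : rat) : (ratr x : algC)^* = ratr x.
Proof. by apply: fmorph_rat. Qed.

Lemma conj_int (x : int) : (x%:~R : algC)^* = x%:~R.
Proof. by rewrite rmorph_int. Qed.

Lemma omega_conj l : (omega l)^* = -1 - omega l.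
Proof.
rewrite /omega rmorphM rmorphD /= rmorphN1 sqrtNeg_conj fmorphV rmorph_nat.
by field.
Qed.

Lemma conj_lattice l (x y : int) :
  (x%:~R - y%:~R * omega l)^* = x%:~R - y%:~R * (-1 - omega l).
Proof. by rewrite rmorphB rmorphM /= omega_conj !conj_int. Qed.

Lemma omega_sqr l d : l = (4 * d - 1)%N -> (0 < d)%N ->
  omega l ^+ 2 = - omega l - d%:R.
Proof.
move=> -> d0; rewrite /omega expr_div_n sqrrD sqrtNeg_sqr.
rewrite natrB ?natrM; last by rewrite muln_gt0.
by field.
Qed.

Lemma omega_Aint l d : l = (4 * d - 1)%N -> (0 < d)%N -> omega l \in Aint.
Proof.
move=> ld d0; apply: (@root_monic_Aint ('X^2 + 'X + d%:R%:P)).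
- by rewrite rootE !hornerE (omega_sqr ld d0); apply/eqP; ring.
- rewrite -addrA monicE lead_coefDl ?lead_coefXn //.
  by rewrite size_polyXn (leq_ltn_trans (size_polyD _ _)) // size_polyX
    gtn_max /= (leq_ltn_trans (size_polyC_leq1 _)).
- apply/polyOverP => i; rewrite !coefD coefXn coefX coefC.
  by rewrite !rpredD ?rpred_nat //; case: ifP; rewrite ?rpred_nat ?rpred0.
Qed.

Lemma omega_inj l (x y x' y' : int) : (0 < l)%N ->
  x%:~R - y%:~R * omega l = x'%:~R - y'%:~R * omega l -> x = x' /\ y = y'.
Proof.
move=> l0 E; have E' := congr1 (fun z : algC => z^* ) E.
rewrite !conj_lattice in E'.
have : (y - y')%:~R * sqrtNeg l = 0.
  have -> : sqrtNeg l = 1 + omega l *+ 2 by rewrite /omega; field.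
  rewrite rmorphB /=; move: E E'; move: (omega l) => w E E'.
  have -> : (y%:~R - y'%:~R) * (1 + w *+ 2)
    = (x%:~R - y%:~R * (-1 - w) - (x'%:~R - y'%:~R * (-1 - w)))
      - (x%:~R - y%:~R * w - (x'%:~R - y'%:~R * w)) by ring.
  by rewrite E E' !subrr.
move/eqP; rewrite mulf_eq0 (negPf (sqrtNeg_neq0 l0)) orbF intr_eq0 subr_eq0.
move=> /eqP yy; split=> //; move: E; rewrite yy => /addIr /eqP.
by rewrite eqr_int => /eqP.
Qed.

Lemma norm_Qd l d (x y : int) : l = (4 * d - 1)%N -> (0 < d)%N ->
  `|x%:~R - y%:~R * omega l| ^+ 2 = (Qd d x y)%:~R.
Proof.
move=> ld d0; rewrite normCK conj_lattice.
have w2 := omega_sqr ld d0.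
have -> : (x%:~R - y%:~R * omega l) * (x%:~R - y%:~R * (-1 - omega l)) =
  x%:~R ^+ 2 + x%:~R * y%:~R + y%:~R ^+ 2 * (- (omega l ^+ 2) - omega l) by ring.
by rewrite w2 /Qd !rmorphD !rmorphM /= -pmulrn !expr2; ring.
Qed.

Lemma OK_Zomega l d : square_free l -> l = (4 * d - 1)%N -> (0 < d)%N ->
  OK l = [set z | exists x y : int, z = x%:~R + y%:~R * omega l].
Proof.
move=> lsf ld d0; have l0 : (0 < l)%N by rewrite ld; lia.
apply/seteqP; split=> z /=; last first.
  move=> [x [y ->]]; split; last first.
    by rewrite /= rpredD ?Aint_int // rpredM ?Aint_int ?(omega_Aint ld).
  exists (x%:~R - y%:~R / 2), (y%:~R / 2).
  by rewrite rmorphB /= !fmorph_div /= !ratr_int ratr_nat /omega; field.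
move=> [[x [y zE]] zA].
have zcE : z^* = ratr x - ratr y * sqrtNeg l.
  by rewrite zE rmorphD [X in _ + X]rmorphM /= !conj_rat sqrtNeg_conj mulrN.
have zcA : z^* \in Aint by rewrite Aint_aut.
have trE : z + z^* = ratr (x *+ 2).
  by rewrite zcE zE addrACA subrr addr0 [RHS]rmorphMn mulr2n.
have nmE : z * z^* = ratr (x ^+ 2 + l%:R * y ^+ 2).
  have -> : z * z^* = ratr x ^+ 2 - ratr y ^+ 2 * sqrtNeg l ^+ 2.
    by rewrite zcE zE; move: (ratr x) (ratr y) (sqrtNeg l) => u v w; ring.
  rewrite sqrtNeg_sqr mulrN opprK mulrC [RHS]rmorphD [X in _ = _ + X]rmorphM /=.
  by rewrite [X in _ = X + _]rmorphXn [X in _ = _ + _ * X]rmorphXn /= ratr_nat.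
have : z + z^* \in Num.int.
  by apply: Cint_rat_Aint; [rewrite trE Crat_rat | rewrite rpredD].
have : z * z^* \in Num.int.
  by apply: Cint_rat_Aint; [rewrite nmE Crat_rat | rewrite rpredM].
rewrite trE nmE.
rewrite !Cint_rat => /intrP[n nE] /intrP[a aE].
(* (2y)^2 l is an integer and l is square-free, hence 2y is an integer *)
have y2E : l%:R * (y *+ 2) ^+ 2 = (4 * n - a ^+ 2)%:~R.
  by rewrite rmorphB rmorphM rmorphXn /= -nE -aE; ring.
set t := y *+ 2 in y2E.
have tE : t = (numq t)%:~R / (denq t)%:~R by rewrite divq_num_den.
have D0 : (denq t)%:~R != 0 :> rat by rewrite intr_eq0 denq_eq0.
have main : l%:Z * numq t ^+ 2 = (4 * n - a ^+ 2) * denq t ^+ 2.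
  have tD : t * (denq t)%:~R = (numq t)%:~R by rewrite {1}tE divfK.
  apply/eqP; rewrite -(eqr_int rat) intrM [X in _ == X]intrM -y2E !expr2 !intrM.
  by rewrite -tD -pmulrn; apply/eqP; ring.
have den1 : `|denq t|%N = 1%N.
  apply: lsf; have cp := coprime_num_den t.
  have : (`|denq t| ^ 2 %| l * `|numq t| ^ 2)%N.
    have := congr1 absz main; rewrite [LHS]abszM [RHS]abszM !abszX /= => ->.
    exact: dvdn_mull.
  by rewrite Gauss_dvdl // coprime_sym coprimeXl // coprimeXr.
have tI : t = (numq t)%:~R.
  rewrite {1}tE; have -> : denq t = 1 by have := denq_gt0 t; lia.
  by rewrite divr1.
set b := numq t in tI.
have par : a ^+ 2 + l%:Z * b ^+ 2 = 4 * n.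
  apply/eqP; rewrite -(eqr_int rat) [X in _ == X]intrM -nE intrD !expr2 !intrM.
  by rewrite -tI -aE -pmulrn /t; apply/eqP; ring.
have [c cE] : exists c : int, a + b = 2 * c.
  have [c cE] : exists c : int, (a + b) ^+ 2 = 2 * c.
    exists (2 * n + a * b + (1 - 2 * d%:Z) * b ^+ 2).
    have lZ : l%:Z = 4 * d%:Z - 1 by rewrite ld; lia.
    rewrite -[2 * (_ + _)]/(2 * _).
    transitivity (a ^+ 2 + l%:Z * b ^+ 2 + 2 * (a * b) + (1 - l%:Z) * b ^+ 2).
      by ring.
    by rewrite par lZ; ring.
  exists ((a + b) %/ 2)%Z.
  have : (2 %| (a + b))%Z.
    have : (2 %| (a + b) ^+ 2)%Z by apply/dvdzP; exists c; rewrite cE mulrC.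
    by rewrite !dvdzE abszX Euclid_dvdX // andbT.
  by move/divzK => H; rewrite mulrC H.
exists c, b.
have xE : x = a%:~R / 2 by rewrite -aE; field.
have yE : y = b%:~R / 2 by rewrite -tI /t; field.
rewrite zE xE yE !fmorph_div /= !ratr_int ratr_nat /omega.
have -> : a = 2 * c - b by rewrite -cE addrK.
by rewrite rmorphB rmorphM /=; field.
Qed.

Section Theta.
Variables (l d p : nat) (a b : int).
Hypotheses (l_sqf : square_free l) (ld : l = (4 * d - 1)%N) (d0 : (0 < d)%N).
Hypothesis p_gt0 : (0 < p)%N.

Let pt (t : int * int) : algC :=
  (a + t.1 * p%:Z)%:~R - (b + t.2 * p%:Z)%:~R * omega l.

Lemma LambdaE :
  Lambda l p a b = [set a%:~R + m%:~R * p%:R - (b%:~R + n%:~R * p%:R) * omega l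
                   | m in [set: int] & n in [set: int]].
Proof.
rewrite /Lambda (OK_Zomega l_sqf ld d0); apply/seteqP; split=> z /=.
  move=> [_ [x [y ->]] <-]; exists x => //; exists (- y) => //.
  by rewrite rmorphN /=; ring.
move=> [x _ [y _ <-]]; exists (x%:~R + (- y)%:~R * omega l).
  by exists x, (- y).
by rewrite rmorphN /=; ring.
Qed.

Let Lambda_pt : Lambda l p a b = pt @` setT.
Proof.
rewrite LambdaE; apply/seteqP; split=> z /=.
  move=> [m _ [n _ <-]]; exists (m, n) => //.
  by rewrite /pt !rmorphD !rmorphM.
by move=> [[m n] _ <-]; exists m => //; exists n => //; rewrite /pt !rmorphD !rmorphM.
Qed.

Let pt_norm t : `|pt t| ^+ 2 = (Qd d (t.1 * p%:Z + a) (t.2 * p%:Z + b))%:~R.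
Proof. by rewrite (norm_Qd _ _ ld d0) ![_ + _ * p%:Z]addrC. Qed.

Let pt_inj : injective pt.
Proof.
have l0 : (0 < l)%N by rewrite ld; lia.
move=> [x y] [x' y'] /(omega_inj l0)[/= /addrI E1 /addrI E2].
have p0 : p%:Z != 0 by lia.
by rewrite (mulIf p0 E1) (mulIf p0 E2).
Qed.

Lemma Qd_ge0 x y : 0 <= Qd d x y.
Proof.
suff : 0 <= 4 * Qd d x y by lia.
have -> : 4 * Qd d x y = (2 * x + y) ^+ 2 + (4 * d%:Z - 1) * y ^+ 2.
  by rewrite /Qd; ring.
by rewrite addr_ge0 ?sqr_ge0 // mulr_ge0 ?sqr_ge0 //; lia.
Qed.

Lemma Lambda_norm_nat z : Lambda l p a b z -> `|z| ^+ 2 \in Num.nat.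
Proof.
rewrite Lambda_pt => -[t _ <-]; rewrite pt_norm.
by case: (Qd _ _ _) (Qd_ge0 (t.1 * p%:Z + a) (t.2 * p%:Z + b)) => // n _;
  rewrite -pmulrn natr_nat.
Qed.

Let finite_pt N : finite_set [set t | (Qd d (t.1 * p%:Z + a) (t.2 * p%:Z + b))%:~R = N%:R :> algC].
Proof.
have finI (c : int) (M : nat) : finite_set [set x : int | (`|(x * p%:Z + c)%R| <= M)%N].
  apply: (@sub_finite_set _ _ ((fun k : nat => k%:Z - (M + `|c|)%N%:Z) @` `I_(M + `|c| + M + `|c|).+1)).
    move=> x /= xM; exists `|(x + (M + `|c|)%N%:Z)%R|%N => /=.
      have : (`|x| <= `|(x * p%:Z)%R|)%N by rewrite abszM leq_pmulr.
      by move=> /=; lia.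
    have : (`|x| <= `|(x * p%:Z)%R|)%N by rewrite abszM leq_pmulr.
    by lia.
  exact/finite_image/finite_II.
apply: sub_finite_set (finite_setX (finI a (4 * N)%N) (finI b (4 * N)%N)).
move=> [x y] /=; move: (x * _ + a) (y * _ + b) => {}x {}y.
rewrite pmulrn => /eqP; rewrite eqr_int => /eqP QN.
have e1 : 4 * N%:Z = (2 * x + y) ^+ 2 + (4 * d%:Z - 1) * y ^+ 2.
  by rewrite -QN /Qd; ring.
have e2 : 4 * d%:Z * N%:Z = (x + 2 * d%:Z * y) ^+ 2 + (4 * d%:Z - 1) * x ^+ 2.
  by rewrite -QN /Qd; ring.
have s1 := sqr_ge0 (2 * x + y); have s2 := sqr_ge0 (x + 2 * d%:Z * y).
have d1 : 1 <= d%:Z by lia.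
have y2 : y ^+ 2 <= 4 * N%:Z.
  have : 0 <= (4 * d%:Z - 2) * y ^+ 2 by rewrite mulr_ge0 ?sqr_ge0 //; lia.
  by nia.
have x2 : x ^+ 2 <= 4 * N%:Z.
  have h : 0 <= (3 * d%:Z - 1) * x ^+ 2 by rewrite mulr_ge0 ?sqr_ge0 //; lia.
  have : d%:Z * x ^+ 2 <= d%:Z * (4 * N%:Z) by nia.
  by rewrite ler_pM2l //; lia.
by split; nia.
Qed.

Let fiberE N : [set z | Lambda l p a b z /\ `|z| ^+ 2 = N%:R] =
  pt @` [set t | (Qd d (t.1 * p%:Z + a) (t.2 * p%:Z + b))%:~R = N%:R :> algC].
Proof.
rewrite Lambda_pt; apply/seteqP; split=> z /=.
  by move=> [[t _ <-]]; rewrite pt_norm => tN; exists t.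
by move=> [t tN <-]; split; [exists t|rewrite pt_norm].
Qed.

Lemma Lambda_finite N : finite_set [set z | Lambda l p a b z /\ `|z| ^+ 2 = N%:R].
Proof. by rewrite fiberE; apply: finite_image. Qed.

Lemma theta_LambdaE : theta (Lambda l p a b) =
  qsum [set: int * int]
    (fun t => (Qd d (t.1 * p%:Z + a) (t.2 * p%:Z + b))%:~R).
Proof.
apply/funext => N; rewrite /theta /qsum; congr Posz.
rewrite fiberE fset_set_image //.
rewrite (card_imfset _ _ pt_inj); congr #|` fset_set _|.
by apply/seteqP; split=> t //= [].
Qed.

End Theta.

(* Main.v *)
(** Negation and complex conjugation are isometries of C; they map the coset of
    (a, b) onto the cosets of (-a, -b) and (a + b, -b), because
    conj omega = -1 - omega, and hence preserve theta series.  The pair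
    (-a - b, b) is the composite of the two. *)
Require Import Defs.
From mathcomp Require Import all_boot all_order all_algebra.
From mathcomp Require Import all_field finmap.
From mathcomp Require Import boolp classical_sets functions cardinality.
From mathcomp Require Import ring.

Import Order.TTheory GRing.Theory Num.Theory.
Local Open Scope classical_set_scope.
Local Open Scope ring_scope.

(** For each N, [g] restricts to a bijection between the elements of squared norm N in [A] and those
    in its image, so the coefficients agree. [A] is arbitrary, so its fibers [F] may be infinite. *)
Lemma theta_isometry (g : algC -> algC) (A : set algC) :
  injective g -> (forall z, `|g z| = `|z|) -> theta (g @` A) = theta A.
Proof.
move=> g_inj g_norm; apply/funext => N; rewrite /theta /qsum; congr Posz.
set F := [set z | A z /\ _].
have -> : [set z | (g @` A) z /\ `|z| ^+ 2 = N%:R] = g @` F.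
  apply/seteqP; split=> z /=.
    by move=> [[x Ax <-]]; rewrite g_norm => xN; exists x.
  by move=> [x [Ax xN] <-]; rewrite g_norm; split=> //; exists x.
have [finF|infF] := pselect (finite_set F).
  by rewrite fset_set_image // card_imfset.
(* [fset_set] is the junk value [fset0] on infinite sets. *)
have infgF : ~ finite_set (g @` F).
  by rewrite (eq_finite_set (inj_card_eq (in2W g_inj))).
by rewrite /fset_set; case: pselect => // ?; case: pselect.
Qed.

Section CosetSymmetries.
Variables (l d p : nat).
Hypotheses (l_sqf : square_free l) (l_d : l = (4 * d - 1)%N) (d_gt0 : (0 < d)%N).

(** Here [a] and [b] enter only through their residues, so symmetries of cosets reduce to
    congruences between coordinates. *)
Lemma mem_Lambda (a b : int) (z : algC) :
  Lambda l p a b z <-> exists x y : int,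
    [/\ (x = a %[mod p])%Z, (y = b %[mod p])%Z & z = x%:~R - y%:~R * omega l].
Proof.
rewrite (LambdaE p a b l_sqf l_d d_gt0); split=> /=.
  move=> [i _ [j _ <-]]; exists (a + i * p%:Z), (b + j * p%:Z).
  split; rewrite ?[_ + _ * p%:Z]addrC ?modzMDl //.
  by rewrite !rmorphD !rmorphM /=; ring.
move=> [x [y [/eqP + /eqP + ->]]]; rewrite !eqz_mod_dvd.
move=> /dvdzP[i xE] /dvdzP[j yE]; exists i => //; exists j => //.
by rewrite -(subrK a x) -(subrK b y) xE yE !rmorphD !rmorphM /=; ring.
Qed.

Lemma eq_Lambda (a b m n : int) :
  (m = a %[mod p])%Z -> (n = b %[mod p])%Z -> Lambda l p m n = Lambda l p a b.
Proof.
by move=> ma nb; apply/seteqP; split=> z; rewrite !mem_Lambda ma nb.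
Qed.

Lemma LambdaN (a b : int) : Lambda l p (- a) (- b) = -%R @` Lambda l p a b.
Proof.
(* Stated for all cosets: applied to [(-a, -b)], it also yields the reverse inclusion, negation
   being an involution. *)
have sub (a' b' : int) z : Lambda l p a' b' z -> Lambda l p (- a') (- b') (- z).
  move=> /mem_Lambda[x [y [xa yb ->]]]; apply/mem_Lambda; exists (- x), (- y).
  by rewrite -modzNm xa modzNm -(modzNm y) yb modzNm !rmorphN; split=> //=; ring.
apply/seteqP; split=> z /=; last by move=> [x /sub + <-].
by move=> /sub; rewrite !opprK => Az; exists (- z); rewrite ?opprK.
Qed.

(** Since the conjugate of [omega l] is [-1 - omega l], conjugation sends the coordinates [(x, y)]
    to [(x + y, -y)], an involution. *)
Lemma Lambda_conj (a b : int) :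
  Lambda l p (a + b) (- b) = Num.conj @` Lambda l p a b.
Proof.
have sub (a' b' : int) z :
    Lambda l p a' b' z -> Lambda l p (a' + b') (- b') z^*.
  move=> /mem_Lambda[x [y [xa yb ->]]]; apply/mem_Lambda; exists (x + y), (- y).
  rewrite -modzDm xa yb modzDm -modzNm yb modzNm conj_lattice rmorphN rmorphD.
  by split=> //=; ring.
apply/seteqP; split=> z /=; last by move=> [x /sub + <-].
by move=> /sub; rewrite addrK opprK => Az; exists z^*; rewrite ?conjCK.
Qed.

Lemma theta_LambdaN (a b : int) :
  theta (Lambda l p (- a) (- b)) = theta (Lambda l p a b).
Proof. by rewrite LambdaN theta_isometry; [|apply: oppr_inj|apply: normrN]. Qed.

Lemma theta_Lambda_conj (a b : int) :
  theta (Lambda l p (a + b) (- b)) = theta (Lambda l p a b).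
Proof.
by rewrite Lambda_conj theta_isometry; [|apply: (can_inj conjCK)|apply: norm_conjC].
Qed.

End CosetSymmetries.

Theorem lemma2 (l d : nat) (l_gt0 : (0 < l)%N) (l_sqf : square_free l)
    (l_mod4 : l = 3 %[mod 4]) (d_gt0 : (0 < d)%N) (l_d : l = (4 * d - 1)%N)
    (p : nat) (p_prime : prime p) (a b m n : int) :
  [\/ (m = a %[mod p])%Z /\ (n = b %[mod p])%Z,
      (m = - a - b %[mod p])%Z /\ (n = b %[mod p])%Z,
      (m = - a %[mod p])%Z /\ (n = - b %[mod p])%Z
    | (m = a + b %[mod p])%Z /\ (n = - b %[mod p])%Z] ->
  theta (Lambda l p m n) = theta (Lambda l p a b).
Proof.
have eqL := @eq_Lambda l d p l_sqf l_d d_gt0.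
have thN := @theta_LambdaN l d p l_sqf l_d d_gt0.
have thC := @theta_Lambda_conj l d p l_sqf l_d d_gt0.
case=> -[ma nb]; rewrite (eqL _ _ _ _ ma nb) //.
(* Only the pair [(-a - b, b)] is left. With [b] written as [- - b], it is the conjugate of the
   coset of [(-a, -b)]. *)
by rewrite -[b in Lambda _ _ _ b]opprK thC thN.
Qed.
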